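(* The set \[ \left\{\frac{x}{\big(\mu_{\mathfrak C}([0,x])\big)^{\log_s p}}:\ x\in \mathfrak C\cap\left[\tfrac{h(1)}{p},1\right]\right\} \] is exactly the set of accumulation points of the sequence $(b_n)_{n\ge 1}$.
   Context: Fix integers $p\ge 3$ and $2\le s<p$, and a set $A\subset\{0,1,\dots,p-1\}$ with $\#A=s$. Let $h:\{0,1,\dots,s-1\}\to A$ be the unique strictly increasing bijection. For a positive integer $n$ with base-$s$ expansion $n=\sum_{i=0}^k\varepsilon_i s^i$ ($\varepsilon_i\in\{0,\dots,s-1\}$, $\varepsilon_k\ne 0$), put $a_n=\sum_{i=0}^k h(\varepsilon_i)p^i$ (the integer whose base-$p$ digits are $h(\varepsilon_k),\dots,h(\varepsilon_0)$). Let $b_n=a_n/n^{\log_s p}$ for $n\ge1$. Let $\mathfrak C=\{x\in[0,1]:$ all digits in the base-$p$ expansion of $x$ belong to $A\}$, the attractor of the maps $S_i(x)=(x+h(i))/p$, $0\le i\le s-1$, and let $\mu_{\mathfrak C}$ be the unique Borel probability measure with $\mu_{\mathfrak C}=\sum_{i=0}^{s-1}\frac1s\,\mu_{\mathfrak C}\circ S_i^{-1}$. An accumulation point of $(b_n)$ is a real number that is the limit of $b_{n_k}$ for some strictly increasing sequence of indices $(n_k)$. *)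

(* Defs.v *)
From HB Require Import structures.
From mathcomp Require Import all_boot all_order all_algebra.
From mathcomp Require Import all_classical all_reals all_analysis.
Set Implicit Arguments. Unset Strict Implicit. Unset Printing Implicit Defensive.
Import Order.TTheory GRing.Theory Num.Theory.
Import numFieldNormedType.Exports.
Local Open Scope classical_set_scope.
Local Open Scope ring_scope.

Definition hdig (p : nat) (A : {set 'I_p}) (i : nat) : nat :=
  nth 0%N (sort leq [seq val x | x <- enum A]) i.

(* a_n : replace the base-s digits eps_i of n (eps_k <> 0, k = trunc_log s n)
   by h(eps_i) and read the result in base p. *)
Definition a_seq (p s : nat) (A : {set 'I_p}) (n : nat) : nat :=
  (\sum_(i < (trunc_log s n).+1) hdig A ((n %/ s ^ i) %% s) * p ^ i)%N.

Definition b_seq {R : realType} (p s : nat) (A : {set 'I_p}) (n : nat) : R :=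
  (a_seq s A n)%:R / ((n%:R : R) `^ (ln (p%:R : R) / ln (s%:R : R))).

(* The Cantor-type set C: points of [0,1] admitting a base-p expansion
   with all digits in A (= attractor of the maps S_i). *)
Definition cantor {R : realType} (p : nat) (A : {set 'I_p}) : set R :=
  [set x | exists d : nat -> 'I_p, (forall k, d k \in A) /\
     (fun n => \sum_(k < n) ((d k : nat)%:R / (p%:R) ^+ k.+1) : R) @ \oo --> x].

Definition S_map {R : realType} (p : nat) (A : {set 'I_p}) (i : nat) (x : R) : R :=
  (x + (hdig A i)%:R) / p%:R.

Definition accum_pt {R : realType} (u : nat -> R) (y : R) : Prop :=
  exists nk : nat -> nat, (forall k, (0 < nk k)%N) /\
    (forall k, (nk k < nk k.+1)%N) /\ (u \o nk) @ \oo --> y.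

(* Main.v *)
(* Read the base-s digits of n after a radix point: n / s^(k+1) and
   a_n / p^(k+1) become finite digit expansions t and x with the same digits
   e_0 e_1 ..., in bases s and p, and since s^(log_s p) = p one gets
   b_n = x / t^(log_s p). On the Cantor set, self-similarity forces mu [0,x] to
   be the base-s number t whose digits are the ranks of the base-p digits of x.
   So approximating an infinite digit sequence with e_0 <> 0 by its prefixes
   realizes every value as an accumulation point, and conversely a digitwise
   convergent subsequence (König) of the digits of n_k gives the point x of an
   accumulation point.
   The constraint x >= h(1)/p does not quite say e_0 <> 0: when e_0 = 0 it
   forces x = h(1)/p and the value h(1). That h(1) is an accumulation point is
   clear if h(0) = 0; if h(0) > 0 it holds because b_n, whose numerators
   increase, starts above h(1) at n = s^m and is below it at n = s^(m+1) - 1,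
   hence it crosses h(1) in between with a small jump. *)
Require Import Defs.
From HB Require Import structures.
From mathcomp Require Import all_boot all_order all_algebra.
From mathcomp Require Import all_classical all_reals all_analysis.
From mathcomp Require Import zify ring lra.
Import Order.TTheory GRing.Theory Num.Theory.
Import numFieldNormedType.Exports.
Local Open Scope classical_set_scope.
Local Open Scope ring_scope.

(** * Finite digit strings and compactness of digit sequences *)

(* Digits are listed from the most significant one, f 0, as in psum below, so
   that the prefixes of an infinite digit sequence give nested integers. *)
Fixpoint nval (r : nat) (f : nat -> nat) (m : nat) : nat :=
  if m is m'.+1 then (r * nval r f m' + f m')%N else 0%N.

Lemma eq_nval r f g m : (forall k, (k < m)%N -> f k = g k) ->
  nval r f m = nval r g m.
Proof.
elim: m => //= m IH fg.
by rewrite fg // IH // => k km; apply: fg; lia.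
Qed.

Lemma nval_lt r f m : (0 < r)%N -> (forall k, (f k < r)%N) -> (nval r f m < r ^ m)%N.
Proof.
move=> r0 fr; elim: m => //= m IH.
by have := fr m; rewrite expnS; nia.
Qed.

Lemma nval_gt0 r f m : (0 < r)%N -> (0 < f 0)%N -> (0 < nval r f m.+1)%N.
Proof. by move=> r0 f0; elim: m => [|m IH] /=; [lia | rewrite addn_gt0 muln_gt0 r0 IH]. Qed.

(** Strong induction on [n]: the quotient by [s] supplies all digits but the last, and the remainder
    is appended. Values of [e] beyond index [m] are arbitrary digits. *)
Lemma nval_onto s n : (1 < s)%N -> (0 < n)%N ->
  exists e m, [/\ (forall k, (e k < s)%N), (0 < e 0)%N & n = nval s e m.+1].
Proof.
move=> s1; have [N nN] := ubnP n; elim: N n nN => // N IH n nN n0.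
have [ns|sn] := ltnP n s.
  by exists (fun=> n), 0%N; split => //=; rewrite muln0.
have q0 : (0 < n %/ s)%N by rewrite divn_gt0; lia.
have qN : (n %/ s < N)%N by have := ltn_Pdiv s1 n0; lia.
have [e [m [es e0 qE]]] := IH _ qN q0.
exists (fun k => if (k <= m)%N then e k else (n %% s)%N), m.+1; split => //.
- by move=> k; case: ifP => // _; rewrite ltn_mod; lia.
- set e' := fun k => _.
  have -> : nval s e' m.+2 = (s * nval s e' m.+1 + e' m.+1)%N by [].
  rewrite (@eq_nval s e' e m.+1) /e' ?ltnn => [|k].
    by rewrite -qE mulnC -divn_eq.
  by rewrite ltnS => ->.
Qed.

(* Compactness of the space of digit sequences: f is built digit by digit,
   keeping infinitely many e_j with the prefix chosen so far. *)
Lemma konig s (e : nat -> nat -> nat) : (forall j k, (e j k < s)%N) ->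
  exists f, (forall k, (f k < s)%N) /\
    forall m N, exists j, (N <= j)%N /\ forall k, (k < m)%N -> e j k = f k.
Proof.
move=> es.
pose P w := forall N, exists j, (N <= j)%N /\
  forall k, (k < size w)%N -> e j k = nth 0%N w k.
(* The implication is placed under the existential so that choice yields a total [g], meaningful
   only on prefixes satisfying [P]. *)
have step w : exists c, P w -> (c < s)%N /\ P (rcons w c).
  have [Pw|nPw] := pselect (P w); last by exists 0%N => /nPw.
  apply: contrapT => /forallNP nP.
  have /choice[N HN] : forall c, exists N, (c < s)%N -> forall j, (N <= j)%N ->
      ~ forall k, (k < size (rcons w c))%N -> e j k = nth 0%N (rcons w c) k.
    move=> c; have [cs|_] := boolP (c < s)%N; last by exists 0%N.
    apply: contrapT => /forallNP H; apply: (nP c) => _; split=> // N.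
    apply: contrapT => /forallNP H'; apply: (H N) => _ j Nj Hj.
    exact: (H' j (conj Nj Hj)).
  (* Pigeonhole: an [e j] with prefix [w] and [j] past every bound [N c] still has some next digit
     below [s], which the bound for that digit excludes. *)
  have [j [Nj Hj]] := Pw (\max_(c < s) N c)%N.
  have Nj' : (N (e j (size w)) <= j)%N.
    by apply: leq_trans Nj; exact: (leq_bigmax (Ordinal (es j (size w)))).
  apply: (HN _ (es j (size w)) j Nj').
  move=> k; rewrite size_rcons ltnS nth_rcons => kw.
  case: ltnP => [/Hj//|wk]; have -> : k = size w by lia.
  by rewrite eqxx.
have [g Hg] := choice step.
pose W := fix W n := if n is n'.+1 then rcons (W n') (g (W n')) else [::].
have PW n : P (W n).
  by elim: n => [N|n IH /=]; [exists N; split | exact: (Hg _ IH).2].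
have sW n : size (W n) = n by elim: n => //= n IH; rewrite size_rcons IH.
have nW m k : (k < m)%N -> nth 0%N (W m) k = g (W k).
  elim: m => //= m IH; rewrite ltnS leq_eqVlt nth_rcons sW => /predU1P[->|km].
    by rewrite ltnn eqxx.
  by rewrite km IH.
exists (fun k => g (W k)); split; first by move=> k; exact: (Hg _ (PW k)).1.
move=> m N; have [j [Nj Hj]] := PW m N; exists j; split=> // k km.
by rewrite Hj ?sW// nW.
Qed.

(** * The digit map h and the integers a_n *)

Section Digits.
Context {p s : nat} {A : {set 'I_p}} (s_gt1 : (1 < s)%N) (cardA : #|A| = s).

Let H := sort leq [seq val x | x <- enum A].

Let size_H : size H = s.
Proof. by rewrite size_sort size_map -cardE. Qed.

Let mem_H x : (x \in H) = (x \in [seq val y | y <- enum A]).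
Proof. by rewrite mem_sort. Qed.

Lemma hdig_lt i j : (i < j)%N -> (j < s)%N -> (hdig A i < hdig A j)%N.
Proof.
move=> ij js; rewrite /hdig -/H.
have : sorted ltn H.
  rewrite ltn_sorted_uniq_leq sort_uniq map_inj_uniq ?enum_uniq; last exact: val_inj.
  exact/sort_sorted/leq_total.
by move/(sorted_ltn_nth ltn_trans 0%N); apply; rewrite ?inE ?size_H ?(ltn_trans ij js).
Qed.

Lemma hdig_mem i : (i < s)%N -> exists2 d : 'I_p, d \in A & hdig A i = d.
Proof.
move=> si; have : hdig A i \in H by apply: mem_nth; rewrite size_H.
by rewrite mem_H => /mapP[d]; rewrite mem_enum => dA ->; exists d.
Qed.

Lemma hdig_onto (d : 'I_p) : d \in A -> exists2 i, (i < s)%N & hdig A i = d.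
Proof.
move=> dA; have dH : val d \in H by rewrite mem_H map_f// mem_enum.
by exists (index (val d) H); [rewrite -size_H index_mem | exact: nth_index].
Qed.

Lemma hdig_ltp i : (i < s)%N -> (hdig A i < p)%N.
Proof. by move=> /hdig_mem[d _ ->]. Qed.

Lemma hdig1_gt0 : (0 < hdig A 1)%N.
Proof. exact: leq_ltn_trans (leq0n _) (hdig_lt 0%N 1%N isT s_gt1). Qed.

Lemma a_seq_small c : (0 < c)%N -> (c < s)%N -> a_seq s A c = hdig A c.
Proof.
move=> c0 cs; rewrite /a_seq (@trunc_log_eq s 0 c) ?expn0 ?c0 ?expn1 ?cs//.
by rewrite big_ord1 !expn0 divn1 modn_small// muln1.
Qed.

(** Appending the digit [c] in base [s] appends h(c) in base [p]. Positivity of [n] makes the digit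
    count grow by exactly one. *)
Lemma a_seq_rec n c : (0 < n)%N -> (c < s)%N ->
  a_seq s A (s * n + c) = (p * a_seq s A n + hdig A c)%N.
Proof.
move=> n0 cs; rewrite /a_seq.
have -> : trunc_log s (s * n + c) = (trunc_log s n).+1.
  apply: trunc_log_eq => //; have := trunc_log_bounds s_gt1 n0.
  by move=> /andP[]; rewrite !expnS; nia.
rewrite big_ord_recl expn0 divn1 muln1 mulnC modnMDl modn_small// addnC.
congr (_ + _)%N; rewrite big_distrr /=; apply: eq_bigr => i _.
rewrite /bump /= add1n !expnS divnMA divnMDl; last lia.
by rewrite (divn_small cs) addn0; lia.
Qed.

Lemma a_seq_nval e m : (forall k, (e k < s)%N) -> (0 < e 0)%N ->
  a_seq s A (nval s e m.+1) = nval p (hdig A \o e) m.+1.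
Proof.
move=> es e0; elim: m => [|m IH]; first by rewrite /= !muln0 !add0n a_seq_small.
rewrite [nval s e m.+2]/= -/(nval s e m.+1) a_seq_rec //; last first.
  by apply: nval_gt0 => //; lia.
by rewrite IH.
Qed.

(** Without a carry, only the last digit changes and h is increasing. With a carry, the quotient
    part gains at least [p] by induction, which outweighs the lost last digit h(c) < [p]. *)
Lemma a_seq_lt n : (0 < n)%N -> (a_seq s A n < a_seq s A n.+1)%N.
Proof.
have [N nN] := ubnP n; elim: N n nN => // N IH n nN n0.
have s0 : (0 < s)%N by lia.
have nE := divn_eq n s; have cs := ltn_pmod n s0.
move: nE cs; set q := (n %/ s)%N; set c := (n %% s)%N; rewrite mulnC => nE cs.
have pc : (hdig A c < p)%N by exact: hdig_ltp.
have [c1s|c1s] := ltnP c.+1 s.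
  have hc := hdig_lt c c.+1 (ltnSn _) c1s.
  have [q0|q0] := posnP q.
    by rewrite nE q0 muln0 add0n !a_seq_small; lia.
  by rewrite nE -addnS !a_seq_rec //; lia.
have -> : n.+1 = (s * q.+1 + 0)%N by lia.
rewrite a_seq_rec //.
have [q0|q0] := posnP q.
  rewrite nE q0 muln0 add0n !a_seq_small //; try lia.
  by have := hdig1_gt0; nia.
rewrite nE a_seq_rec //.
have qN : (q < N)%N by nia.
by have := IH q qN q0; nia.
Qed.

End Digits.

(** * Partial sums of digit expansions in base r *)

Section PartialSums.
Context {R : realType} (r : nat) (r_gt1 : (1 < r)%N).

Definition psum (f : nat -> nat) (m : nat) : R :=
  \sum_(k < m) ((f k)%:R / r%:R ^+ k.+1).

Let r_gt0 : 0 < r%:R :> R.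
Proof. by rewrite ltr0n ltnW. Qed.

Let r_neq0 : r%:R != 0 :> R.
Proof. exact: lt0r_neq0. Qed.

Lemma psumS f m : psum f m.+1 = psum f m + (f m)%:R / r%:R ^+ m.+1.
Proof. by rewrite /psum big_ord_recr. Qed.

(** Peeling off the leading digit is the form that matches the maps S_i. *)
Lemma psumSl f m : psum f m.+1 = ((f 0%N)%:R + psum (f \o succn) m) / r%:R.
Proof.
rewrite /psum big_ord_recl expr1 mulrDl mulr_suml; congr (_ + _).
by apply: eq_bigr => k _; rewrite lift0 /= -mulrA -invfM -exprSr.
Qed.

Lemma psum_nval f m : psum f m = (nval r f m)%:R / r%:R ^+ m.
Proof.
elim: m => [|m IH]; first by rewrite /psum big_ord0 mul0r.
rewrite psumS IH /= natrD natrM exprS.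
have : r%:R ^+ m != 0 :> R by rewrite expf_neq0.
by move=> rm0; field; rewrite rm0 r_neq0.
Qed.

Lemma psum_ge0 f m : 0 <= psum f m.
Proof. by apply: sumr_ge0 => k _; rewrite divr_ge0 ?exprn_ge0. Qed.

Lemma psum_le1 f m : (forall k, (f k < r)%N) -> psum f m <= 1.
Proof.
elim: m f => [|m IH] f fr; first by rewrite /psum big_ord0.
rewrite psumSl ler_pdivrMr// mul1r.
have := IH (f \o succn) (fun k => fr k.+1).
have : (f 0%N + 1)%:R <= r%:R :> R by rewrite ler_nat addn1.
by rewrite natrD; lra.
Qed.

(** Each leading digit peeled off scales the remaining tail by 1/r, and a tail is at most 1. *)
Lemma psum_le_tail f m n : (forall k, (f k < r)%N) ->
  psum f (m + n) <= psum f m + r%:R ^- m.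
Proof.
elim: m f => [|m IH] f fr.
  by rewrite add0n expr0 invr1 {2}/psum big_ord0 add0r psum_le1.
rewrite addSn !psumSl exprS invfM [_^-1 * _]mulrC -mulrDl ler_pM2r ?invr_gt0//.
by have := IH (f \o succn) (fun k => fr k.+1); lra.
Qed.

Lemma nondecreasing_psum f : nondecreasing_seq (psum f).
Proof.
apply/nondecreasing_seqP => m.
by rewrite psumS lerDl divr_ge0// exprn_ge0// ltW.
Qed.

Lemma cvg_psum f : (forall k, (f k < r)%N) -> psum f @ \oo --> limn (psum f).
Proof.
move=> fr; apply: nondecreasing_is_cvgn; first exact: nondecreasing_psum.
by exists 1 => _ [m _ <-]; exact: psum_le1.
Qed.

Lemma psum_le_lim f m : (forall k, (f k < r)%N) -> psum f m <= limn (psum f).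
Proof.
move=> fr; apply: nondecreasing_cvgn_le (nondecreasing_psum f) _ m.
by apply: cvgP; exact: cvg_psum.
Qed.

Lemma lim_psum_le f m : (forall k, (f k < r)%N) ->
  limn (psum f) <= psum f m + r%:R ^- m :> R.
Proof.
move=> fr; apply: limr_le; first exact: cvg_psum.
exists m => // n /= mn; rewrite -(subnKC mn); exact: psum_le_tail.
Qed.

(** Both numbers lie between the common partial sum of length [m] and that sum plus r^-m. *)
Lemma psum_close f g m n : (forall k, (f k < r)%N) -> (forall k, (g k < r)%N) ->
  (m <= n)%N -> (forall k, (k < m)%N -> g k = f k) ->
  `|limn (psum f) - psum g n| <= r%:R ^- m.
Proof.
move=> fr gr mn fg.
have gf : psum g m = psum f m by rewrite !psum_nval (@eq_nval r g f).
have := psum_le_tail g m (n - m) gr; rewrite subnKC// gf.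
have := nondecreasing_psum g m n mn; rewrite gf.
have := psum_le_lim f m fr; have := lim_psum_le f m fr.
by rewrite ler_norml; lra.
Qed.

Lemma cvg_expVn : (r%:R ^- m : R) @[m --> \oo] --> 0.
Proof.
rewrite (_ : (fun m => r%:R ^- m) = GRing.exp r%:R^-1 :> (nat -> R)); last first.
  by apply/funext => m; rewrite exprVn.
by apply: cvg_expr; rewrite normfV ger0_norm ?ltW// invf_lt1// ltr1n.
Qed.

End PartialSums.

(** * Accumulation points and the exponent log_s p *)

Section AccumulationPoints.
Context {R : realType}.

(** Recursive choice: each new index exceeds the previous one and brings the error below 1/(k+1). *)
Lemma accum_ptI (u : nat -> R) y :
  (forall N (e : R), 0 < e -> exists2 n, (N <= n)%N & `|y - u n| < e) -> accum_pt u y.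
Proof.
move=> H.
have /choice[g gP] : forall Nk : nat * nat, exists n, (Nk.1 < n)%N /\
    `|y - u n| < (Nk.2.+1%:R)^-1.
  move=> [N k] /=; have [|n Nn nk] := H N.+1 (k.+1%:R)^-1; first by rewrite invr_gt0.
  by exists n.
pose nk := fix nk k := if k is k'.+1 then g (nk k', k) else g (0%N, 0%N).
exists nk; split; first by case=> [|k]; apply: leq_ltn_trans (gP _).1.
split; first by move=> k; exact: (gP (_, _)).1.
have nkP k : `|y - u (nk k)| <= (k.+1%:R)^-1.
  by case: k => [|k]; apply/ltW; exact: (gP (_, _)).2.
apply/cvgrPdist_lt => e e0.
have := near_infty_natSinv_lt (PosNum e0).
by apply: filterS => k; exact: le_lt_trans (nkP k).
Qed.

End AccumulationPoints.

Lemma continuous_powR {R : realType} (a t : R) : 0 < t -> {for t, continuous (@powR R ^~ a)}.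
Proof.
move=> t0; apply: differentiable_continuous; apply/derivable1_diffP.
by apply: derivable_powR; rewrite in_itv /= t0.
Qed.

Lemma powR_log {R : realType} (s p m : nat) : (1 < s)%N -> (0 < p)%N ->
  (s%:R ^+ m : R) `^ (ln p%:R / ln s%:R) = p%:R ^+ m.
Proof.
move=> s1 p0; rewrite -!powR_mulrn// powRAC; congr (_ `^ _).
have lns0 : 0 < ln s%:R :> R by rewrite ln_gt0// ltr1n.
rewrite /powR pnatr_eq0 gtn_eqF 1?ltnW// divfK ?gt_eqF//.
by rewrite lnK// posrE ltr0n.
Qed.

(** * Values of infinite digit expansions *)

Section Limits.
Context {R : realType} (r : nat) (r_gt1 : (1 < r)%N).

Lemma lim_psumSl f : (forall k, (f k < r)%N) ->
  limn (psum (R := R) r f) = ((f 0%N)%:R + limn (psum r (f \o succn))) / r%:R.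
Proof.
move=> fr; apply: cvg_lim => //; rewrite -cvg_shiftS /=.
rewrite (_ : (fun m => _) = fun m => ((f 0%N)%:R + psum r (f \o succn) m) / r%:R).
  apply: cvgMr_tmp; apply: cvgD; first exact: cvg_cst.
  exact: (cvg_psum r r_gt1 (f \o succn) (fun k => fr k.+1)).
by apply/funext => m; exact: psumSl.
Qed.

Lemma lim_psum_ge0 f : (forall k, (f k < r)%N) -> 0 <= limn (psum (R := R) r f).
Proof. by move=> fr; apply: le_trans (psum_le_lim r r_gt1 f 0%N fr); exact: psum_ge0. Qed.

Lemma lim_psum_le1 f : (forall k, (f k < r)%N) -> limn (psum (R := R) r f) <= 1.
Proof.
move=> fr; apply: le_trans (lim_psum_le r r_gt1 f 0%N fr) _.
by rewrite /psum big_ord0 expr0 invr1 add0r.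
Qed.

End Limits.

(** * The distribution function of a self-similar measure *)

(* G is the distribution function x |-> mu ]-oo, x] of the self-similar measure. *)
Section SelfSimilarCdf.
Context {R : realType} {p s : nat} {A : {set 'I_p}} (p_gt1 : (1 < p)%N).
Context (s_gt1 : (1 < s)%N) (cardA : #|A| = s) (G : R -> R).
Hypothesis G_homo : {homo G : x y / x <= y}.
Hypothesis G_ge0 : forall x, 0 <= G x.
Hypothesis G_le1 : forall x, G x <= 1.
Hypothesis G_Ny : forall e : R, 0 < e -> exists x, G x < e.
Hypothesis G_y : forall e : R, 0 < e -> exists x, 1 - e < G x.
(** Invariance of the measure tested on rays: the preimage of ]-oo, x] under S_i is ]-oo, p x -
    h(i)]. *)
Hypothesis G_inv : forall x, G x = s%:R^-1 * \sum_(i < s) G (p%:R * x - (hdig A i)%:R).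

Let s_gt0 : 0 < s%:R :> R. Proof. by rewrite ltr0n ltnW. Qed.

Let G_avg_le x c : (forall i, (i < s)%N -> G (p%:R * x - (hdig A i)%:R) <= c) -> G x <= c.
Proof.
move=> H; rewrite G_inv ler_pdivrMl//.
apply: (@le_trans _ _ (\sum_(i < s) c)); first by apply: ler_sum => i _; exact: H.
by rewrite sumr_const card_ord mulr_natl.
Qed.

Let G_avg_ge x c : (forall i, (i < s)%N -> c <= G (p%:R * x - (hdig A i)%:R)) -> c <= G x.
Proof.
move=> H; rewrite G_inv ler_pdivlMl//.
apply: (@le_trans _ _ (\sum_(i < s) c)); last by apply: ler_sum => i _; exact: H.
by rewrite sumr_const card_ord mulr_natl.
Qed.

Let expr_unbounded (d x : R) : 0 < d -> exists k, x <= p%:R ^+ k * d.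
Proof.
move=> d0; exists (Num.truncn (x / d)).+1.
rewrite -ler_pdivrMr//; apply: le_trans (ltW (truncnS_gt _)) _.
by rewrite -natrX ler_nat ltnW// ltn_expl.
Qed.

(** Since p x - h(i) <= p x, averaging gives G(x) <= G(p x) <= ... <= G(p^k x), and p^k x tends to
    -oo. *)
Let G_lt0 x : x < 0 -> G x = 0.
Proof.
move=> x0; apply/eqP; rewrite eq_le G_ge0 andbT; apply/ler_addgt0Pr => e e0.
rewrite add0r; have [z zP] := G_Ny e e0.
have x0' : 0 < - x by rewrite oppr_gt0.
have [k kP] := expr_unbounded _ (- z) x0'.
have {x0 x0'}H : G x <= G (p%:R ^+ k * x).
  elim: k {kP} => [|k IH]; first by rewrite expr0 mul1r.
  apply: le_trans IH _; apply: G_avg_le => i _; apply: G_homo.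
  by rewrite exprS mulrA lerBlDr lerDl.
by apply: le_trans H _; apply: le_trans (ltW zP); apply: G_homo; lra.
Qed.

(** Mirror argument, expanding about 1: h(i) <= p - 1 gives p x - h(i) >= 1 + p (x - 1). *)
Let G_gt1 x : 1 < x -> G x = 1.
Proof.
move=> x1; apply/eqP; rewrite eq_le G_le1/=; apply/ler_addgt0Pr => e e0.
have [z zP] := G_y e e0.
have x1' : 0 < x - 1 by rewrite subr_gt0.
have [k kP] := expr_unbounded _ z x1'.
have {x1 x1'}H : G (1 + p%:R ^+ k * (x - 1)) <= G x.
  elim: k {kP} => [|k IH]; first by rewrite expr0 mul1r addrC subrK.
  apply: le_trans IH; apply: G_avg_ge => i si; apply: G_homo.
  have : (hdig A i).+1%:R <= p%:R :> R by rewrite ler_nat; exact: (hdig_ltp cardA).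
  by rewrite exprS -natr1; lra.
have : G z <= G (1 + p%:R ^+ k * (x - 1)) by apply: G_homo; lra.
by lra.
Qed.

(* At x = 0 only the summand with h(i) = 0 survives, so G 0 <= G 0 / s: no atom. *)
Lemma selfsim_le0 x : x <= 0 -> G x = 0.
Proof.
rewrite le_eqVlt => /predU1P[->|]; last exact: G_lt0.
apply/eqP; rewrite eq_le G_ge0 andbT.
have : G 0 <= s%:R^-1 * G 0.
  rewrite {1}G_inv ler_pM2l ?invr_gt0//.
  case: s s_gt1 cardA => // s' s'1 cA; rewrite big_ord_recl big1 => [|i _].
    by rewrite addr0; apply: G_homo; rewrite mulr0 sub0r oppr_le0.
  apply: G_lt0; rewrite mulr0 sub0r oppr_lt0 ltr0n.
  have i1 : (lift ord0 i < s'.+1)%N by [].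
  have := hdig_lt cA 0%N (lift ord0 i) isT i1.
  by move/(leq_ltn_trans (leq0n _)).
have s2 : s%:R^-1 <= 2^-1 :> R by rewrite lef_pV2 ?posrE// ler_nat.
by have := G_ge0 0; nra.
Qed.

(** At x = 1 every summand with i < s - 1 equals 1 and the last is at least G(1), so G(1) >= (s - 1
    + G(1)) / s, which forces G(1) = 1. *)
Lemma selfsim_ge1 x : 1 <= x -> G x = 1.
Proof.
rewrite le_eqVlt => /predU1P[<-|]; last exact: G_gt1.
apply/eqP; rewrite eq_le G_le1/=.
have : s%:R^-1 * (s.-1%:R + G 1) <= G 1.
  rewrite [leRHS]G_inv ler_pM2l ?invr_gt0//.
  case: s s_gt1 cardA => // s' s'1 cA; rewrite big_ord_recr/= lerD//.
    rewrite -[s' in s'%:R]card_ord -sumr_const; apply: ler_sum => i _.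
    rewrite G_gt1// mulr1 ltrBrDl.
    have := hdig_lt cA i s' (ltn_ord i) (ltnSn _); have := hdig_ltp cA s' (ltnSn _).
    by rewrite natr1 ltr_nat; lia.
  apply: G_homo; rewrite mulr1 lerBrDl natr1 ler_nat; exact: (hdig_ltp cA).
rewrite -subn1 natrB 1?ltnW// mulrDr mulrBr mulVf ?lt0r_neq0//.
have s2 : s%:R^-1 <= 2^-1 :> R by rewrite lef_pV2 ?posrE// ler_nat.
by have := G_le1 1; nra.
Qed.

Let X e : R := limn (psum p (hdig A \o e)).

(** Under the digit shift, G(X e) obeys the same recursion as the base-[s] value of [e]; each
    application divides the discrepancy by [s]. *)
Lemma selfsim_psum e : (forall k, (e k < s)%N) -> G (X e) = limn (psum s e).
Proof.
have hp (f : nat -> nat) : (forall k, (f k < s)%N) -> forall k, ((hdig A \o f) k < p)%N.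
  by move=> fs k; exact: (hdig_ltp cardA).
have GX f : (forall k, (f k < s)%N) ->
    G (X f) = ((f 0%N)%:R + G (X (f \o succn))) / s%:R.
  move=> fs; rewrite G_inv mulrC; congr (_ / _).
  have X1 := lim_psum_ge0 p p_gt1 _ (hp (f \o succn) (fun k => fs k.+1)).
  have X2 := lim_psum_le1 p p_gt1 _ (hp (f \o succn) (fun k => fs k.+1)).
  have {}X1 : 0 <= X (f \o succn) := X1 R.
  have {}X2 : X (f \o succn) <= 1 := X2 R.
  have -> : p%:R * X f = (hdig A (f 0%N))%:R + X (f \o succn).
    by rewrite /X (lim_psumSl p p_gt1 _ (hp f fs)) mulrC divfK// pnatr_eq0; lia.
  (* Split the sum at i = [f 0]. Distinct values of h differ by at least 1, so smaller i have
     argument at least 1 and contribute 1, while larger i have argument at most 0 and contribute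
     0. *)
  rewrite -(big_mkord xpredT (fun i => G (_ + _ - (hdig A i)%:R))).
  have f0 := fs 0%N.
  rewrite (big_cat_nat (n := f 0%N))//=; last exact: ltnW.
  rewrite (big_ltn f0) addrAC subrr add0r; congr (_ + _).
    rewrite big_nat (eq_bigr (fun=> 1)) => [|i /andP[_ i0]].
      by rewrite -big_nat sumr_const_nat subn0.
    apply: selfsim_ge1; have := hdig_lt cardA i (f 0%N) i0 f0.
    by rewrite -(ler_nat R) -natr1; lra.
  rewrite big_nat big1 ?addr0// => i /andP[i0 si].
  apply: selfsim_le0; have := hdig_lt cardA (f 0%N) i i0 si.
  by rewrite -(ler_nat R) -natr1; lra.
(* Iterating the recursion [m] times leaves an unknown value of G in [0,1], scaled by s^-m. *)
have bnd m : forall f, (forall k, (f k < s)%N) ->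
    psum s f m <= G (X f) <= psum s f m + s%:R ^- m.
  elim: m => [|m IH] f fs.
    by rewrite /psum big_ord0 expr0 invr1 add0r G_ge0 G_le1.
  have := IH _ (fun k => fs k.+1); rewrite (GX f fs) !psumSl// exprS invfM.
  rewrite [_^-1 * _]mulrC -mulrDl !ler_pM2r ?invr_gt0//.
  by move=> /andP[H1 H2]; apply/andP; split; move: H1 H2; rewrite /comp; lra.
move=> es; apply/esym/cvg_lim => //.
apply/cvgrPdist_le => d d0.
have /cvgrPdist_le/(_ d d0) := @cvg_expVn R s s_gt1.
apply: filterS => m; rewrite sub0r normrN => H; apply: le_trans H.
have /andP[H1 H2] := bnd m e es.
rewrite [leRHS]ger0_norm; last by rewrite invr_ge0 exprn_ge0.
by rewrite ler_norml; lra.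
Qed.

End SelfSimilarCdf.

(** * The mass that the self-similar measure gives to [0,x] *)

Section SelfSimilarMeasure.
Context {R : realType} {p s : nat} {A : {set 'I_p}} (p_gt1 : (1 < p)%N).
Context (s_gt1 : (1 < s)%N) (cardA : #|A| = s).
Context (mu : {measure set (measurableTypeR R) -> \bar R}) (mu1 : mu setT = 1%E).
Hypothesis mu_inv : forall B : set (measurableTypeR R), measurable B ->
  mu B = (\sum_(i < s) ((s%:R)^-1)%:E * mu (S_map A i @^-1` B))%E.

Let ray (x : R) : set (measurableTypeR R) := [set t : R | t <= x].

Let measurable_ray x : measurable (ray x).
Proof.
rewrite /ray (_ : [set _ | _] = `]-oo, x]%classic); last by rewrite set_itvE.
exact: measurable_itv.
Qed.

Let fin_mu B : measurable B -> mu B \is a fin_num.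
Proof.
move=> mB; rewrite ge0_fin_numE//; apply: (@le_lt_trans _ _ (mu setT)).
  by apply: le_measure; rewrite ?inE.
by rewrite mu1 ltry.
Qed.

Let G x : R := fine (mu (ray x)).

Let GE x : (G x)%:E = mu (ray x).
Proof. by rewrite fineK// fin_mu. Qed.

Let G_homo : {homo G : x y / x <= y}.
Proof.
move=> x y xy; rewrite -lee_fin !GE le_measure ?inE//.
by move=> t /le_trans; apply.
Qed.

Let G_ge0 x : 0 <= G x.
Proof. by rewrite -lee_fin GE. Qed.

Let G_le1 x : G x <= 1.
Proof. by rewrite -lee_fin GE -mu1 le_measure ?inE. Qed.

Let G_inv x : G x = s%:R^-1 * \sum_(i < s) G (p%:R * x - (hdig A i)%:R).
Proof.
apply: EFin_inj; rewrite GE mu_inv// -ge0_sume_distrr//.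
rewrite EFinM -sumEFin; congr (_ * _)%E; apply: eq_bigr => i _.
rewrite GE; congr (mu _); apply/seteqP; split=> t /=; rewrite /S_map /ray /=;
  by rewrite ler_pdivrMr ?ltr0n 1?ltnW// lerBrDr mulrC.
Qed.

Let G_Ny (e : R) : 0 < e -> exists x, G x < e.
Proof.
move=> e0.
have H : mu (ray (- n%:R)) @[n --> \oo] --> mu (\bigcap_n ray (- n%:R)).
  apply: nonincreasing_cvg_mu => //.
  - by rewrite -ge0_fin_numE// fin_mu.
  - exact: bigcapT_measurable.
  - move=> m n mn; apply/subsetPset => t; rewrite /ray /= => /le_trans; apply.
    by rewrite lerN2 ler_nat.
move: H; rewrite (_ : \bigcap_n _ = set0) ?measure0; last first.
  rewrite -subset0 => t /(_ (Num.truncn (- t)).+1 I); rewrite /ray /= leNgt.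
  by rewrite ltrNl truncnS_gt.
move/fine_cvg => /=; move/cvgrPdist_lt/(_ e e0) => [n _ /(_ n (leqnn n))] /=.
by rewrite sub0r normrN ger0_norm// => ?; exists (- n%:R).
Qed.

Let G_y (e : R) : 0 < e -> exists x, 1 - e < G x.
Proof.
move=> e0.
have H : mu (ray n%:R) @[n --> \oo] --> mu (\bigcup_n ray n%:R).
  apply: nondecreasing_cvg_mu => //.
  - exact: bigcupT_measurable.
  - move=> m n mn; apply/subsetPset => t; rewrite /ray /= => /le_trans; apply.
    by rewrite ler_nat.
move: H; rewrite (_ : \bigcup_n _ = setT) ?mu1; last first.
  rewrite -subTset => t _; exists (Num.truncn t).+1 => //.
  by rewrite /ray /= ltW// truncnS_gt.
move/fine_cvg => /=; move/cvgrPdist_lt/(_ e e0) => [n _ /(_ n (leqnn n))] /=.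
by rewrite -/(G _) ger0_norm ?subr_ge0// => ?; exists n%:R; lra.
Qed.

(** The whole ray up to 0, the point 0 included, is null, so cutting off the negative half-line
    loses no mass. *)
Let mu_itv0 x : mu [set t : R | 0 <= t <= x] = mu (ray x).
Proof.
set B := [set t | _].
have mB : measurable (B : set (measurableTypeR R)).
  rewrite /B (_ : [set _ | _] = `[0, x]%classic); last by rewrite set_itvE.
  exact: measurable_itv.
apply/eqP; rewrite eq_le; apply/andP; split.
  by apply: le_measure; rewrite ?inE// => t /andP[].
have G0 : mu (ray 0) = 0%E.
  by rewrite -GE (selfsim_le0 p_gt1 s_gt1 cardA G).
rewrite -[leRHS]add0e -G0.
apply: (@le_trans _ _ (mu (ray 0 `|` B))); last exact: measureU2.
apply: le_measure; rewrite ?inE//; first exact: measurableU.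
move=> t; rewrite /ray /B /= => tx.
by have [t0|t0] := lerP t 0; [left | right; rewrite /= tx ltW].
Qed.

Lemma mass_itv0_psum e : (forall k, (e k < s)%N) ->
  fine (mu [set t : R | 0 <= t <= limn (psum p (hdig A \o e))]) = limn (psum s e).
Proof.
by move=> es; rewrite mu_itv0 -(selfsim_psum p_gt1 s_gt1 cardA G).
Qed.

Lemma mass_itv01 : fine (mu [set t : R | 0 <= t <= 1]) = 1.
Proof. by rewrite mu_itv0; apply: (selfsim_ge1 p_gt1 s_gt1 cardA G). Qed.

End SelfSimilarMeasure.

(** * Tools for limits of b_n and for crossing a level *)

Lemma cvg_ratio {R : realType} {T : Type} {F : set_system T} {FF : Filter F}
    (f g : T -> R) (a x t : R) : 0 < t -> f @ F --> x -> g @ F --> t ->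
  (fun i => f i / g i `^ a) @ F --> x / t `^ a.
Proof.
move=> t0 fx gt; apply: cvgM => //; apply: cvgV; first by rewrite gt_eqF// powR_gt0.
by apply: (@continuous_cvg _ _ _ F FF g (@powR R ^~ a)) => //; exact: continuous_powR.
Qed.

(** Serves the crossing of the level h(1), with x = 1 + 1/k for the jump size and x = 1 - s^-(m+1)
    for the right end. *)
Lemma powR_near1 {R : realType} (a e : R) : 0 < e ->
  exists2 d, 0 < d & forall x, `|1 - x| < d -> `|1 - x `^ a| < e.
Proof.
move=> e0; have /cvgrPdist_lt/(_ e e0)/nbhs_ballP[d d0 H] :=
  continuous_powR a (1 : R) ltr01.
by exists d => // x xd; have := H x xd; rewrite /= powR1.
Qed.

Lemma a_seq_ltX {p s : nat} {A : {set 'I_p}} : (1 < s)%N -> #|A| = s ->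
  forall m n, (0 < n)%N -> (n < s ^ m)%N -> (a_seq s A n < p ^ m)%N.
Proof.
move=> s1 cA; elim=> [|m IH] n n0 nm; first by rewrite expn0 in nm; lia.
have s0 : (0 < s)%N by lia.
rewrite (divn_eq n s) mulnC; have cs := ltn_pmod n s0.
have hp := hdig_ltp cA _ cs.
have [q0|q0] := posnP (n %/ s).
  have c0 : (0 < n %% s)%N by move: n0; rewrite {1}(divn_eq n s) q0.
  rewrite q0 muln0 add0n a_seq_small//; apply: (leq_trans hp).
  by rewrite expnS leq_pmulr// expn_gt0 (leq_ltn_trans (leq0n _) hp).
rewrite a_seq_rec//; have := IH (n %/ s)%N q0; rewrite ltn_divLR// -expnSr => /(_ nm).
by rewrite expnS; nia.
Qed.

Lemma crossing (P : nat -> Prop) m n : (m <= n)%N -> P m -> ~ P n ->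
  exists k, [/\ (m <= k)%N, P k & ~ P k.+1].
Proof.
elim: n => [|n IH] mn Pm nPn; first by move: mn; rewrite leqn0 => /eqP m0; rewrite m0 in Pm.
have [mSn|mn'] : m = n.+1 \/ (m <= n)%N by lia.
  by rewrite mSn in Pm.
have [Pn|/IH[]//] := pselect (P n); last by move=> k; exists k.
by exists n.
Qed.

(** * Accumulation points of (b_n) through digit sequences *)

Section BSequence.
Context {R : realType} {p s : nat} {A : {set 'I_p}} (p_gt1 : (1 < p)%N).
Context (s_gt1 : (1 < s)%N) (cardA : #|A| = s).

Let alpha : R := ln (p%:R : R) / ln (s%:R : R).
Let b : nat -> R := b_seq s A.

Let powR_alpha m : (s%:R ^+ m : R) `^ alpha = p%:R ^+ m.
Proof. by apply: powR_log; rewrite // ltnW. Qed.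

(** Numerator and denominator are both divided by p^(m+1), which is the power [alpha] of s^(m+1). *)
Lemma b_nval e m : (forall k, (e k < s)%N) -> (0 < e 0)%N ->
  b (nval s e m.+1) = psum p (hdig A \o e) m.+1 / (psum s e m.+1) `^ alpha.
Proof.
move=> es e0; rewrite /b /b_seq -/alpha a_seq_nval// !psum_nval//.
set n := nval s e m.+1; set a := nval p _ _.
have sm0 : s%:R ^+ m.+1 != 0 :> R by rewrite expf_neq0// pnatr_eq0; lia.
have pm0 : p%:R ^+ m.+1 != 0 :> R by rewrite expf_neq0// pnatr_eq0; lia.
have -> : (n%:R : R) `^ alpha = (n%:R / s%:R ^+ m.+1) `^ alpha * p%:R ^+ m.+1.
  by rewrite -powR_alpha -powRM ?divfK// ?divr_ge0 ?exprn_ge0.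
by rewrite invfM mulrA mulrAC.
Qed.

Lemma b_expn m : b (s ^ m) = (a_seq s A (s ^ m))%:R / p%:R ^+ m.
Proof. by rewrite /b /b_seq -/alpha natrX powR_alpha. Qed.

Let lim_psum_gt0 e : (forall k, (e k < s)%N) -> (0 < e 0)%N ->
  0 < limn (psum (R := R) s e).
Proof.
move=> es e0; apply: lt_le_trans (psum_le_lim s s_gt1 e 1%N es).
by rewrite /psum big_ord1 divr_gt0 ?exprn_gt0 ?ltr0n//; lia.
Qed.

Lemma accum_digits e : (forall k, (e k < s)%N) -> (0 < e 0)%N ->
  accum_pt b (limn (psum p (hdig A \o e)) / limn (psum s e) `^ alpha).
Proof.
move=> es e0; exists (fun m => nval s e m.+1).
have n0 m : (0 < nval s e m.+1)%N by apply: nval_gt0 => //; lia.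
split=> //; split.
  by move=> m; rewrite [nval s e m.+2]/= -/(nval s e m.+1); have := n0 m; nia.
rewrite (_ : b \o _ = fun m => psum p (hdig A \o e) m.+1 / (psum s e m.+1) `^ alpha).
  apply: cvg_ratio; first exact: lim_psum_gt0.
    rewrite (cvg_shiftS (psum p (hdig A \o e))); apply: cvg_psum => // k.
    exact: (hdig_ltp cardA).
  by rewrite (cvg_shiftS (psum s e)); exact: cvg_psum.
by apply/funext => m; exact: b_nval.
Qed.

Lemma accum_hdig1 : accum_pt b (hdig A 1)%:R.
Proof.
set v := hdig A 1; apply: accum_ptI => N e e0.
have hp0 : 0 < p%:R :> R by rewrite ltr0n; lia.
have v0 : (0 < v)%N by exact: (hdig1_gt0 s_gt1 cardA).
have aS m : a_seq s A (s ^ m.+1) = (p * a_seq s A (s ^ m) + hdig A 0)%N.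
  by rewrite -(a_seq_rec s_gt1 cardA) ?addn0 ?expnS// ?expn_gt0; lia.
have a1 : a_seq s A (s ^ 0) = v by rewrite expn0 a_seq_small.
(* If h(0) = 0, then b_n equals h(1) at every power of [s]. *)
have [h0|h0] := posnP (hdig A 0).
  exists (s ^ N)%N; first by rewrite ltnW// ltn_expl.
  rewrite b_expn (_ : a_seq _ _ _ = v * p ^ N)%N.
    by rewrite natrM natrX mulfK ?subrr ?normr0// expf_neq0// gt_eqF.
  elim: N => [|N IH]; first by rewrite a1 muln1.
  by rewrite aS IH h0 addn0 expnS mulnCA.
have v2 : (1 < v)%N by have := hdig_lt cardA 0%N 1%N isT s_gt1; rewrite -/v; lia.
have ev0 : 0 < e / v%:R by rewrite divr_gt0// ltr0n.
have [d d0 dP] := powR_near1 alpha _ ev0.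
have half0 : 0 < 2^-1 :> R by [].
have [d' d'0 d'P] := powR_near1 alpha _ half0.
have [M1 _ M1P] := near_infty_natSinv_lt (PosNum d0).
have /cvgrPdist_lt/(_ d' d'0)[M2 _ M2P] := @cvg_expVn R s s_gt1.
(* The crossing index k >= s^m > m then lies beyond [N] and satisfies 1/k < [d], while s^-(m+1) <
   [d']. *)
pose m := (maxn N (maxn M1 M2)).+1.
pose P n := v%:R * n%:R `^ alpha <= (a_seq s A n)%:R :> R.
have sm1 : (m < s ^ m)%N by exact: ltn_expl.
have [k [mk Pk nPk]] : exists k, [/\ (s ^ m <= k)%N, P k & ~ P k.+1].
  apply: (@crossing P (s ^ m) (s ^ m.+1).-1).
  - by rewrite expnS; nia.
  - rewrite /P natrX powR_alpha -natrX -natrM ler_nat.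
    elim: m {sm1} => [|m IH]; first by rewrite a1 muln1.
    by rewrite aS expnS; nia.
  (* Right end n = s^(m+1) - 1: here a_n < p^(m+1), whereas v n^alpha = v (1 - s^-(m+1))^alpha
     p^(m+1) is larger, since v >= 2 and the middle factor exceeds 1/2. *)
  - apply/negP; rewrite -ltNge.
    have -> : ((s ^ m.+1).-1)%:R = (1 - s%:R ^- m.+1) * s%:R ^+ m.+1 :> R.
      rewrite mulrBl mul1r mulVf ?expf_neq0 ?pnatr_eq0 ?gtn_eqF// 1?ltnW//.
      by rewrite -subn1 natrB ?natrX// expn_gt0 ltnW.
    have sm_le1 : s%:R ^- m.+1 <= 1 :> R.
      by rewrite invf_le1 ?exprn_gt0 ?exprn_ege1 ?ler1n ?ltr0n//; lia.
    rewrite powRM ?exprn_ge0 ?subr_ge0// powR_alpha mulrA.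
    have /d'P : `|1 - (1 - s%:R ^- m.+1)| < d'.
      by have := M2P m.+1; rewrite /= sub0r normrN opprB addrCA subrr addr0; apply; rewrite /m; lia.
    rewrite ltr_norml => /andP[_ H].
    have va : 1 < v%:R * (1 - s%:R ^- m.+1) `^ alpha.
      have : 2 <= v%:R :> R by rewrite ler_nat.
      by nra.
    have aP : (a_seq s A (s ^ m.+1).-1)%:R < p%:R ^+ m.+1 :> R.
      by rewrite -natrX ltr_nat; apply: a_seq_ltX => //; rewrite expnS; nia.
    apply: lt_trans aP _; rewrite ltr_pMl// exprn_gt0//.
exists k; first by move: mk sm1; rewrite /m; lia.
have k0 : (0 < k)%N by lia.
have ka0 : 0 < (k%:R : R) `^ alpha by rewrite powR_gt0// ltr0n.
(* Monotone numerators bound the jump: a_k <= a_(k+1) < v (k+1)^alpha, hence v <= b_k < v (1 +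
   1/k)^alpha < v + e. *)
have akS : (a_seq s A k)%:R <= (a_seq s A k.+1)%:R :> R.
  by rewrite ler_nat ltnW// a_seq_lt.
have {}nPk : (a_seq s A k.+1)%:R < v%:R * k.+1%:R `^ alpha :> R.
  by rewrite ltNge; apply/negP.
rewrite (_ : k.+1%:R = k%:R * (1 + k%:R^-1)) in nPk; last first.
  by rewrite mulrDr mulr1 divff ?natr1// pnatr_eq0; lia.
rewrite powRM// in nPk.
have /dP : `|1 - (1 + k%:R^-1)| < d :> R.
  rewrite opprD addrA subrr add0r normrN ger0_norm//.
  have := M1P k.-1; rewrite /= prednK//; apply.
  by move: mk sm1; rewrite /m; lia.
rewrite ltr_norml ltrBrDl => /andP[H _].
have {}H : (1 + k%:R^-1) `^ alpha < 1 + e / v%:R by lra.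
have bk : b k * k%:R `^ alpha = (a_seq s A k)%:R.
  by rewrite /b /b_seq divfK// gt_eqF.
have v0' : 0 < v%:R :> R by rewrite ltr0n.
have bkl : v%:R <= b k by rewrite -(ler_pM2r ka0) bk.
have bku : b k < v%:R * (1 + k%:R^-1) `^ alpha.
  by rewrite -(ltr_pM2r ka0) bk; lra.
have : v%:R * (1 + k%:R^-1) `^ alpha < v%:R + e.
  by rewrite -ltr_pdivlMl// mulrDr mulVf ?gt_eqF// mulrC.
by rewrite ltr_norml => ?; apply/andP; split; lra.
Qed.

Lemma digits_of_accum y : accum_pt b y -> exists e,
  [/\ (forall k, (e k < s)%N), (0 < e 0)%N &
      y = limn (psum p (hdig A \o e)) / limn (psum s e) `^ alpha].
Proof.
move=> [nk [nk0 [nkS nky]]].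
have /choice[E EP] : forall j, exists em : (nat -> nat) * nat,
    [/\ (forall k, (em.1 k < s)%N), (0 < em.1 0)%N & nk j = nval s em.1 em.2.+1].
  by move=> j; have [e [m H]] := nval_onto s (nk j) s_gt1 (nk0 j); exists (e, m).
have [f [fs fP]] := konig s (fun j => (E j).1) (fun j => let: And3 h _ _ := EP j in h).
have nk_ge j : (j <= nk j)%N by elim: j => // j IH; exact: leq_ltn_trans IH (nkS j).
have /choice[J JP] : forall m, exists j, [/\ (m <= j)%N, (m <= (E j).2.+1)%N &
    forall k, (k < m)%N -> (E j).1 k = f k].
  (* Asking for j >= s^m gives nk j >= s^m, so nk j has at least [m] genuine digits and agreement is
     not with padding. *)
  move=> m; have [j [Nj Hj]] := fP m (s ^ m)%N; exists j; split => //.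
    by apply: leq_trans Nj; rewrite ltnW// ltn_expl.
  have [es _ nkE] := EP j.
  have := nval_lt s (E j).1 (E j).2.+1 (ltnW s_gt1) es; rewrite -nkE => H.
  by apply/ltnW; rewrite -(ltn_exp2l _ _ s_gt1); apply: leq_ltn_trans H; exact: leq_trans (nk_ge j).
have f0 : (0 < f 0)%N by have [_ _ <-//] := JP 1%N; have [] := EP (J 1%N).
exists f; split => //.
have hp e : (forall k, (e k < s)%N) -> forall k : nat, ((hdig A \o e) k < p)%N.
  by move=> es k; exact: (hdig_ltp cardA).
(* [J] need not be increasing; m <= [J m] already preserves the limit. *)
have cvg_b : (fun m => b (nk (J m))) @ \oo --> y.
  apply: (cvg_comp J (b \o nk) _ nky) => S [n _ nS]; exists n => // m /= nm.
  by apply: nS; rewrite /=; have [mJ _ _] := JP m; exact: leq_trans mJ.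
apply/esym; rewrite -(cvg_lim _ cvg_b)//; apply/esym/cvg_lim => //.
rewrite (_ : (fun m => _) = fun m => psum p (hdig A \o (E (J m)).1) (E (J m)).2.+1 /
    (psum s (E (J m)).1 (E (J m)).2.+1) `^ alpha); last first.
  by apply/funext => m; have [es e0 ->] := EP (J m); exact: b_nval.
apply: cvg_ratio; first exact: lim_psum_gt0.
- apply/cvgrPdist_le => d d0; have /cvgrPdist_le/(_ d d0) := @cvg_expVn R p p_gt1.
  apply: filterS => m; rewrite sub0r normrN ger0_norm ?invr_ge0 ?exprn_ge0//.
  apply: le_trans; have [_ mE Jf] := JP m; have [es _ _] := EP (J m).
  apply: psum_close => //; [exact: hp|exact: hp|].
  by move=> k km; rewrite /= Jf.
- apply/cvgrPdist_le => d d0; have /cvgrPdist_le/(_ d d0) := @cvg_expVn R s s_gt1.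
  apply: filterS => m; rewrite sub0r normrN ger0_norm ?invr_ge0 ?exprn_ge0//.
  apply: le_trans; have [_ mE Jf] := JP m; have [es _ _] := EP (J m).
  exact: psum_close.
Qed.

End BSequence.

(** * Equality of the two sets *)

Theorem theorem1 (R : realType) (p s : nat) (A : {set 'I_p})
  (mu : {measure set (measurableTypeR R) -> \bar R}) :
  (3 <= p)%N -> (2 <= s)%N -> (s < p)%N -> #|A| = s ->
  mu setT = 1%E ->
  (forall B : set (measurableTypeR R), measurable B ->
     mu B = (\sum_(i < s) ((s%:R)^-1)%:E * mu (S_map A i @^-1` B))%E) ->
  [set y : R | exists2 x : R, x \in @cantor R p A /\
        ((hdig A 1)%:R / p%:R <= x <= 1) &
        y = x / (fine (mu [set t : R | 0 <= t <= x]) `^ (ln (p%:R : R) / ln (s%:R : R)))]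
  = [set y : R | accum_pt (b_seq s A) y].
Proof.
move=> p3 s_gt1 _ cardA mu1 mu_inv.
have p_gt1 : (1 < p)%N by lia.
have hp e : (forall k, (e k < s)%N) -> forall k : nat, ((hdig A \o e) k < p)%N.
  by move=> es k; exact: (hdig_ltp cardA).
have mass e := @mass_itv0_psum R p s A p_gt1 s_gt1 cardA mu mu1 mu_inv e.
have p0 : 0 < p%:R :> R by rewrite ltr0n; lia.
apply/seteqP; split=> y /=.
  move=> [x [xC /andP[hx x1]] ->]; move: xC; rewrite inE => -[d [dA dx]].
  (* [e k] is the rank in [A] of the k-th digit of x. *)
  have /choice[e eP] : forall k, exists i, (i < s)%N /\ hdig A i = d k.
    by move=> k; have [i] := hdig_onto cardA (d k) (dA k); exists i.
  have es k : (e k < s)%N := (eP k).1.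
  have xE : x = limn (psum p (hdig A \o e)).
    apply/esym/cvg_lim => //; rewrite (_ : psum _ _ = fun n =>
      \sum_(k < n) ((d k : nat)%:R / (p%:R) ^+ k.+1) : R)//.
    by apply/funext => n; apply: eq_bigr => k _; rewrite /= (eP k).2.
  rewrite {2}xE mass//.
  have [e0|e0] := posnP (e 0%N); last by rewrite xE; exact: accum_digits.
  have es' k : ((e \o succn) k < s)%N := es k.+1.
  have xS : x = ((hdig A 0)%:R + limn (psum p (hdig A \o (e \o succn)))) / p%:R.
    by rewrite xE (lim_psumSl p p_gt1 _ (hp e es)) /= e0.
  have X1 := lim_psum_le1 (R := R) p p_gt1 _ (hp _ es').
  have h01 : (hdig A 0)%:R + 1 <= (hdig A 1)%:R :> R.
    by rewrite natr1 ler_nat (hdig_lt cardA).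
  have hx' : (hdig A 1)%:R <= (hdig A 0)%:R + limn (psum p (hdig A \o (e \o succn))) :> R.
    by move: hx; rewrite xS ler_pM2r ?invr_gt0.
  (* The shifted point is at most 1 and h(0) + 1 <= h(1), so x >= h(1)/p leaves only equality. *)
  have X1E : limn (psum p (hdig A \o (e \o succn))) = 1 :> R by lra.
  have -> : limn (psum s e) = s%:R^-1 :> R.
    (* The shifted base-[s] value is the mass of [0,1], hence 1, even though its digits have not
       been identified. *)
    rewrite (lim_psumSl s s_gt1 _ es) e0 add0r -mass// X1E.
    by rewrite (mass_itv01 p_gt1 s_gt1 cardA mu mu1 mu_inv) mul1r.
  rewrite (_ : x / _ = (hdig A 1)%:R); first exact: accum_hdig1.
  have -> : x = (hdig A 1)%:R / p%:R by rewrite xS X1E; congr (_ / _); lra.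
  have s0 : s%:R != 0 :> R by rewrite pnatr_eq0 gtn_eqF// ltnW.
  have sa : (s%:R : R) `^ (ln p%:R / ln s%:R) = p%:R.
    by rewrite -[s%:R in LHS]expr1 powR_log// ltnW.
  have : (s%:R^-1 : R) `^ (ln p%:R / ln s%:R) * p%:R = 1.
    by rewrite -[X in _ * X]sa -powRM ?invr_ge0// mulVf// powR1.
  by move=> H; rewrite -mulrA -invfM [p%:R * _]mulrC H invr1 mulr1.
move=> /(digits_of_accum p_gt1 s_gt1 cardA)[e [es e0 ->]].
exists (limn (psum p (hdig A \o e))); last by rewrite mass.
split.
  have /choice[d dP] : forall k, exists d : 'I_p, d \in A /\ hdig A (e k) = d.
    by move=> k; have [d] := hdig_mem cardA (e k) (es k); exists d.
  rewrite inE; exists d; split=> [k|]; first exact: (dP k).1.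
  rewrite (_ : (fun n => _) = psum p (hdig A \o e)); first exact/cvg_psum/hp.
  by apply/funext => n; apply: eq_bigr => k _; rewrite /= (dP k).2.
rewrite (lim_psum_le1 p p_gt1 _ (hp e es)) andbT.
(* The first digit alone suffices: x >= h(e_0)/p >= h(1)/p because e_0 >= 1. *)
apply: le_trans (psum_le_lim p p_gt1 _ 1%N (hp e es)).
rewrite /psum big_ord1 expr1 ler_pM2r ?invr_gt0// ler_nat /=.
have [e1|e1] := eqVneq (e 0%N) 1%N; first by rewrite e1.
by rewrite ltnW// (hdig_lt cardA)//; have := es 0%N; lia.
Qed.
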